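(* Let $B$ be a non-trivial Boolean algebra. The logical subdistribution monad $\mathrm s\mathsf D_B$ on the category $\mathbf{Set}_B$ of $B$-labelled sets is linear exponential with respect to the symmetric monoidal structure $(\star,\mathbf 0)$ on $\mathbf{Set}_B$; that is, it admits a symmetric opmonoidal structure with respect to $(\star,\mathbf 0)$ for which the lifted symmetric monoidal structure on the category of $\mathrm s\mathsf D_B$-algebras is given by finite coproducts.
   Context: $\mathbf{Set}_B$: objects are pairs $\mathbf X=(X,|\cdot|_{\mathbf X})$ with $X$ a set and $|\cdot|_{\mathbf X}\colon X\to B\setminus\{\bot\}$; maps $\mathbf X\to\mathbf Y$ are functions $f$ with $|f(x)|_{\mathbf Y}=|x|_{\mathbf X}$. $|x|$ is called the domain of $x$, and $X(b)=\{x\in X:|x|=b\}$. A finitely supported logical subdistribution on $\mathbf X$ is a function $\omega\colon X\to B$ such that $\{x:\omega(x)\ne\bot\}$ is finite and non-empty, $\omega(x)\wedge\omega(x')=\bot$ for $x\neq x'$, and $\omega(x)\le|x|_{\mathbf X}$ for all $x$. Its domain is $\omega(X)=\bigvee_x\omega(x)$. $\mathrm s\mathcal D_B(\mathbf X)$ is the $B$-labelled set of these. The monad $\mathrm s\mathsf D_B$ has action on maps by pushforward, $f_*(\omega)(y)=\bigvee_{f(x)=y}\omega(x)$; unit $\eta_{\mathbf X}(x)=$ the subdistribution with value $|x|$ at $x$ and $\bot$ elsewhere; multiplication $\mu_{\mathbf X}(\Omega)(x)=\bigvee_{\omega}\Omega(\omega)\wedge\omega(x)$. The monoidal structure $(\star,\mathbf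 0)$: the unit $\mathbf 0$ is the empty $B$-labelled set, and for $b\in B\setminus\{\bot\}$, $$(\mathbf X\star\mathbf Y)(b)=X(b)+\Bigl(\sum_{b_1,b_2\in B\setminus\{\bot\},\ b_1\vee b_2=b,\ b_1\wedge b_2=\bot}X(b_1)\times Y(b_2)\Bigr)+Y(b),$$ with the evident action on maps. With the convention that $X(\bot)$ is a singleton for every $\mathbf X$, this is $\sum_{b_1,b_2\in B,\ b_1\vee b_2=b,\ b_1\wedge b_2=\bot}X(b_1)\times Y(b_2)$. The associativity constraint identifies both $((\mathbf X\star\mathbf Y)\star\mathbf Z)(b)$ and $(\mathbf X\star(\mathbf Y\star\mathbf Z))(b)$ in the evident way with $\sum_{(r,s,t)}X(r)\times Y(s)\times Z(t)$ (sum over triples $(r,s,t)$ of pairwise disjoint elements of $B$ with join $r\vee s\vee t=b$); the unit constraints and the symmetry (swapping factors) are likewise the evident ones. A symmetric opmonoidal structure on a monad $\mathsf T=(T,\eta,\mu)$ on a symmetric monoidal category $(\mathcal C,\otimes,I)$ consists of a map $\upsilon_I\colon TI\to I$ and natural maps $\upsilon_{XY}\colon T(X\otimes Y)\to TX\otimes TY$ making $T$ a symmetric opmonoidal (colax monoidal) functor and $\eta,\mu$ opmonoidal transformations. It lifts the symmetric monoidal structure of $\mathcal C$ to the category $\mathcal C^{\mathsf T}$ of Eilenberg--Moore algebras: $(X,x)\otimes(Y,y)=(X\otimes Y,(x\otimes y)\circ\upsilon_{XY})$, with unit $(I,\upsilon_I)$ and constraints those of $\mathcal C$. (Such structures correspond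 bijectively to symmetric monoidal structures on $\mathcal C^{\mathsf T}$ for which the forgetful functor is strict symmetric monoidal.) A linear exponential monad is a symmetric opmonoidal monad for which $(I,\upsilon_I)$ is initial in $\mathcal C^{\mathsf T}$ and, for all algebras $(X,x),(Y,y)$, the cospan $(X,x)\cong(X,x)\otimes(I,\upsilon_I)\xrightarrow{1\otimes !}(X,x)\otimes(Y,y)\xleftarrow{!\otimes 1}(I,\upsilon_I)\otimes(Y,y)\cong(Y,y)$ is a coproduct in $\mathcal C^{\mathsf T}$, where $!$ denotes the unique maps out of the initial algebra. *)

(* Defs.v *)
From mathcomp Require Import all_boot all_order.
From mathcomp Require Import boolp classical_sets functions cardinality fsbigop.

Set Implicit Arguments.
Unset Strict Implicit.
Unset Printing Implicit Defensive.

Import Order.Theory.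
#[local] Obligation Tactic := idtac.

Declare Scope cat_scope.
Delimit Scope cat_scope with cat.

Record category := Category {
  obj :> Type;
  hom : obj -> obj -> Type;
  idm : forall X, hom X X;
  comp : forall X Y Z, hom Y Z -> hom X Y -> hom X Z;
  comp_idl : forall X Y (f : hom X Y), comp (idm Y) f = f;
  comp_idr : forall X Y (f : hom X Y), comp f (idm X) = f;
  compA : forall X Y Z W (h : hom Z W) (g : hom Y Z) (f : hom X Y),
    comp h (comp g f) = comp (comp h g) f
}.
Arguments hom {c}.
Arguments idm {c}.
Notation "g ∘ f" := (comp g f) (at level 40, left associativity) : cat_scope.

Local Open Scope cat_scope.

Definition is_initial (C : category) (I : C) : Prop :=
  forall X : C, exists! f : hom I X, True.

Definition is_coproduct (C : category) (X Y P : C)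
    (i : hom X P) (j : hom Y P) : Prop :=
  forall (Z : C) (f : hom X Z) (g : hom Y Z),
    exists! h : hom P Z, h ∘ i = f /\ h ∘ j = g.

Record sym_monoidal (C : category) := SymMonoidal {
  tens : C -> C -> C;
  tensm : forall X X' Y Y', hom X X' -> hom Y Y' ->
    hom (tens X Y) (tens X' Y');
  munit : C;
  assoc : forall X Y Z, hom (tens (tens X Y) Z) (tens X (tens Y Z));
  assocV : forall X Y Z, hom (tens X (tens Y Z)) (tens (tens X Y) Z);
  lunit : forall X, hom (tens munit X) X;
  lunitV : forall X, hom X (tens munit X);
  runit : forall X, hom (tens X munit) X;
  runitV : forall X, hom X (tens X munit);
  symm : forall X Y, hom (tens X Y) (tens Y X);
  tensm_id : forall X Y, tensm (idm X) (idm Y) = idm (tens X Y);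
  tensm_comp : forall X X' X'' Y Y' Y''
      (f' : hom X' X'') (f : hom X X') (g' : hom Y' Y'') (g : hom Y Y'),
    tensm (f' ∘ f) (g' ∘ g) = tensm f' g' ∘ tensm f g;
  assoc_nat : forall X X' Y Y' Z Z'
      (f : hom X X') (g : hom Y Y') (h : hom Z Z'),
    assoc X' Y' Z' ∘ tensm (tensm f g) h =
    tensm f (tensm g h) ∘ assoc X Y Z;
  lunit_nat : forall X X' (f : hom X X'),
    lunit X' ∘ tensm (idm munit) f = f ∘ lunit X;
  runit_nat : forall X X' (f : hom X X'),
    runit X' ∘ tensm f (idm munit) = f ∘ runit X;
  symm_nat : forall X X' Y Y' (f : hom X X') (g : hom Y Y'),
    symm X' Y' ∘ tensm f g = tensm g f ∘ symm X Y;
  assocK : forall X Y Z, assocV X Y Z ∘ assoc X Y Z = idm _;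
  assocVK : forall X Y Z, assoc X Y Z ∘ assocV X Y Z = idm _;
  lunitK : forall X, lunitV X ∘ lunit X = idm _;
  lunitVK : forall X, lunit X ∘ lunitV X = idm _;
  runitK : forall X, runitV X ∘ runit X = idm _;
  runitVK : forall X, runit X ∘ runitV X = idm _;
  symmK : forall X Y, symm Y X ∘ symm X Y = idm _;
  pentagon : forall X Y Z W,
    assoc X Y (tens Z W) ∘ assoc (tens X Y) Z W =
    tensm (idm X) (assoc Y Z W) ∘ assoc X (tens Y Z) W
      ∘ tensm (assoc X Y Z) (idm W);
  triangle : forall X Y,
    tensm (idm X) (lunit Y) ∘ assoc X munit Y = tensm (runit X) (idm Y);
  hexagon : forall X Y Z,
    assoc Y Z X ∘ symm X (tens Y Z) ∘ assoc X Y Z =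
    tensm (idm Y) (symm X Z) ∘ assoc Y X Z ∘ tensm (symm X Y) (idm Z)
}.
Arguments tensm {C} s {X X' Y Y'}.

(* Since the unit is initial, bX and bY are the unique maps out of it. *)
Definition is_cocartesian (C : category) (M : sym_monoidal C) : Prop :=
  is_initial (munit M) /\
  forall (X Y : C) (bX : hom (munit M) X) (bY : hom (munit M) Y),
    is_coproduct (tensm M (idm X) bY ∘ runitV M X)
                 (tensm M bX (idm Y) ∘ lunitV M Y).

Record monad (C : category) := Monad {
  mobj :> C -> C;
  mmap : forall X Y, hom X Y -> hom (mobj X) (mobj Y);
  eta : forall X, hom X (mobj X);
  mu : forall X, hom (mobj (mobj X)) (mobj X);
  mmap_id : forall X, mmap (idm X) = idm (mobj X);
  mmap_comp : forall X Y Z (g : hom Y Z) (f : hom X Y),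
    mmap (g ∘ f) = mmap g ∘ mmap f;
  eta_nat : forall X Y (f : hom X Y), eta Y ∘ f = mmap f ∘ eta X;
  mu_nat : forall X Y (f : hom X Y), mu Y ∘ mmap (mmap f) = mmap f ∘ mu X;
  mu_eta : forall X, mu X ∘ eta (mobj X) = idm (mobj X);
  mu_mmap_eta : forall X, mu X ∘ mmap (eta X) = idm (mobj X);
  mu_mu : forall X, mu X ∘ mu (mobj X) = mu X ∘ mmap (mu X)
}.
Arguments mmap {C} m {X Y}.

Record sym_opmonoidal (C : category) (M : sym_monoidal C) (T : monad C) :=
    SymOpmonoidal {
  upsI : hom (T (munit M)) (munit M);
  ups : forall X Y, hom (T (tens M X Y)) (tens M (T X) (T Y));
  ups_nat : forall X X' Y Y' (f : hom X X') (g : hom Y Y'),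
    ups X' Y' ∘ mmap T (tensm M f g) =
    tensm M (mmap T f) (mmap T g) ∘ ups X Y;
  ups_assoc : forall X Y Z,
    assoc M (T X) (T Y) (T Z) ∘ tensm M (ups X Y) (idm (T Z))
      ∘ ups (tens M X Y) Z =
    tensm M (idm (T X)) (ups Y Z) ∘ ups X (tens M Y Z)
      ∘ mmap T (assoc M X Y Z);
  ups_lunit : forall X,
    lunit M (T X) ∘ tensm M upsI (idm (T X)) ∘ ups (munit M) X =
    mmap T (lunit M X);
  ups_runit : forall X,
    runit M (T X) ∘ tensm M (idm (T X)) upsI ∘ ups X (munit M) =
    mmap T (runit M X);
  ups_symm : forall X Y,
    symm M (T X) (T Y) ∘ ups X Y = ups Y X ∘ mmap T (symm M X Y);
  upsI_eta : upsI ∘ eta T (munit M) = idm (munit M);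
  ups_eta : forall X Y,
    ups X Y ∘ eta T (tens M X Y) = tensm M (eta T X) (eta T Y);
  upsI_mu : upsI ∘ mu T (munit M) = upsI ∘ mmap T upsI;
  ups_mu : forall X Y,
    ups X Y ∘ mu T (tens M X Y) =
    tensm M (mu T X) (mu T Y) ∘ ups (T X) (T Y) ∘ mmap T (ups X Y)
}.

Section EilenbergMoore.
Variables (C : category) (T : monad C).

Record algebra := Algebra {
  acar :> C;
  act : hom (T acar) acar;
  act_eta : act ∘ eta T acar = idm acar;
  act_mu : act ∘ mu T acar = act ∘ mmap T act
}.

Record algebra_hom (A A' : algebra) := AlgebraHom {
  ahom :> hom (acar A) (acar A');
  ahom_act : ahom ∘ act A = act A' ∘ mmap T ahom
}.

Lemma algebra_hom_eq (A A' : algebra) (f g : algebra_hom A A') :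
  ahom f = ahom g -> f = g.
Proof.
case: f g => [f pf] [g pg] /= fg; case: g / fg pg => pg.
by congr AlgebraHom; exact: Prop_irrelevance.
Qed.

Program Definition algebra_id (A : algebra) : algebra_hom A A :=
  @AlgebraHom A A (idm A) _.
Next Obligation. by move=> A; rewrite comp_idl mmap_id comp_idr. Qed.

Program Definition algebra_comp (A1 A2 A3 : algebra)
    (g : algebra_hom A2 A3) (f : algebra_hom A1 A2) : algebra_hom A1 A3 :=
  @AlgebraHom A1 A3 (ahom g ∘ ahom f) _.
Next Obligation.
by move=> *; rewrite -compA ahom_act compA ahom_act -compA -mmap_comp.
Qed.

Program Definition EM : category := @Category algebra algebra_hom
  algebra_id algebra_comp _ _ _.
Next Obligation. by move=> *; apply: algebra_hom_eq; exact: comp_idl. Qed.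
Next Obligation. by move=> *; apply: algebra_hom_eq; exact: comp_idr. Qed.
Next Obligation. by move=> *; apply: algebra_hom_eq; exact: compA. Qed.

End EilenbergMoore.

Section LiftedMonoidal.
Variables (C : category) (M : sym_monoidal C) (T : monad C).
Variable U : sym_opmonoidal M T.

Program Definition alg_tens (A A' : algebra T) : algebra T :=
  @Algebra C T (tens M A A') (tensm M (act A) (act A') ∘ ups U A A') _ _.
Next Obligation.
by move=> A A'; rewrite -compA ups_eta -tensm_comp !act_eta tensm_id.
Qed.
Next Obligation.
move=> A A'; rewrite mmap_comp -compA ups_mu !compA -tensm_comp !act_mu.
by rewrite tensm_comp -!compA; congr (_ ∘ _); rewrite !compA ups_nat.
Qed.

Definition alg_unit : algebra T :=
  @Algebra C T (munit M) (upsI U) (upsI_eta U) (upsI_mu U).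

Program Definition alg_tensm (A A' D D' : algebra T)
    (f : algebra_hom A A') (g : algebra_hom D D') :
    algebra_hom (alg_tens A D) (alg_tens A' D') :=
  @AlgebraHom C T (alg_tens A D) (alg_tens A' D') (tensm M f g) _.
Next Obligation.
move=> A A' D D' f g /=.
by rewrite compA -tensm_comp !ahom_act tensm_comp -!compA ups_nat.
Qed.

Program Definition alg_assoc (A1 A2 A3 : algebra T) :
    algebra_hom (alg_tens (alg_tens A1 A2) A3) (alg_tens A1 (alg_tens A2 A3)) :=
  @AlgebraHom C T (alg_tens (alg_tens A1 A2) A3)
    (alg_tens A1 (alg_tens A2 A3)) (assoc M A1 A2 A3) _.
Next Obligation.
move=> A1 A2 A3 /=.
rewrite -[act A3]comp_idr tensm_comp !compA assoc_nat comp_idr.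
rewrite -[act A1 in RHS]comp_idr [in RHS]tensm_comp.
by rewrite -!compA; congr (_ ∘ _); rewrite !compA ups_assoc.
Qed.

Lemma alg_hom_inv (A A' : algebra T) (f : algebra_hom A A')
    (g : hom (acar A') (acar A)) :
  g ∘ f = idm _ -> f ∘ g = idm _ -> g ∘ act A' = act A ∘ mmap T g.
Proof.
move=> gf fg; rewrite -[act A']comp_idr -(mmap_id T) -fg mmap_comp.
by rewrite [act A' ∘ _]compA -ahom_act !compA gf comp_idl.
Qed.

Program Definition alg_assocV (A1 A2 A3 : algebra T) :
    algebra_hom (alg_tens A1 (alg_tens A2 A3)) (alg_tens (alg_tens A1 A2) A3) :=
  @AlgebraHom C T (alg_tens A1 (alg_tens A2 A3))
    (alg_tens (alg_tens A1 A2) A3) (assocV M A1 A2 A3) _.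
Next Obligation.
move=> A1 A2 A3; apply: (@alg_hom_inv _ _ (alg_assoc A1 A2 A3)).
  exact: assocK.
exact: assocVK.
Qed.

Program Definition alg_lunit (A : algebra T) :
    algebra_hom (alg_tens alg_unit A) A :=
  @AlgebraHom C T (alg_tens alg_unit A) A (lunit M A) _.
Next Obligation.
move=> A /=; rewrite -(ups_lunit U) -[act A in LHS]comp_idr -[upsI U in LHS]comp_idl.
by rewrite tensm_comp !compA lunit_nat.
Qed.

Program Definition alg_lunitV (A : algebra T) :
    algebra_hom A (alg_tens alg_unit A) :=
  @AlgebraHom C T A (alg_tens alg_unit A) (lunitV M A) _.
Next Obligation.
move=> A; apply: (@alg_hom_inv _ _ (alg_lunit A)); first exact: lunitK.
exact: lunitVK.
Qed.

Program Definition alg_runit (A : algebra T) :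
    algebra_hom (alg_tens A alg_unit) A :=
  @AlgebraHom C T (alg_tens A alg_unit) A (runit M A) _.
Next Obligation.
move=> A /=; rewrite -(ups_runit U) -[act A in LHS]comp_idr -[upsI U in LHS]comp_idl.
by rewrite tensm_comp !compA runit_nat.
Qed.

Program Definition alg_runitV (A : algebra T) :
    algebra_hom A (alg_tens A alg_unit) :=
  @AlgebraHom C T A (alg_tens A alg_unit) (runitV M A) _.
Next Obligation.
move=> A; apply: (@alg_hom_inv _ _ (alg_runit A)); first exact: runitK.
exact: runitVK.
Qed.

Program Definition alg_symm (A A' : algebra T) :
    algebra_hom (alg_tens A A') (alg_tens A' A) :=
  @AlgebraHom C T (alg_tens A A') (alg_tens A' A) (symm M A A') _.
Next Obligation.
by move=> A A' /=; rewrite compA symm_nat -!compA ups_symm.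
Qed.

Program Definition EM_sym_monoidal : sym_monoidal (EM T) :=
  @SymMonoidal (EM T) alg_tens alg_tensm alg_unit alg_assoc alg_assocV
    alg_lunit alg_lunitV alg_runit alg_runitV alg_symm
    _ _ _ _ _ _ _ _ _ _ _ _ _ _ _ _.
Next Obligation. by move=> *; apply: algebra_hom_eq; exact: tensm_id. Qed.
Next Obligation. by move=> *; apply: algebra_hom_eq; exact: tensm_comp. Qed.
Next Obligation. by move=> *; apply: algebra_hom_eq; exact: assoc_nat. Qed.
Next Obligation. by move=> *; apply: algebra_hom_eq; exact: lunit_nat. Qed.
Next Obligation. by move=> *; apply: algebra_hom_eq; exact: runit_nat. Qed.
Next Obligation. by move=> *; apply: algebra_hom_eq; exact: symm_nat. Qed.
Next Obligation. by move=> *; apply: algebra_hom_eq; exact: assocK. Qed.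
Next Obligation. by move=> *; apply: algebra_hom_eq; exact: assocVK. Qed.
Next Obligation. by move=> *; apply: algebra_hom_eq; exact: lunitK. Qed.
Next Obligation. by move=> *; apply: algebra_hom_eq; exact: lunitVK. Qed.
Next Obligation. by move=> *; apply: algebra_hom_eq; exact: runitK. Qed.
Next Obligation. by move=> *; apply: algebra_hom_eq; exact: runitVK. Qed.
Next Obligation. by move=> *; apply: algebra_hom_eq; exact: symmK. Qed.
Next Obligation. by move=> *; apply: algebra_hom_eq; exact: pentagon. Qed.
Next Obligation. by move=> *; apply: algebra_hom_eq; exact: triangle. Qed.
Next Obligation. by move=> *; apply: algebra_hom_eq; exact: hexagon. Qed.

End LiftedMonoidal.

Definition linear_exponential (C : category) (M : sym_monoidal C)
    (T : monad C) : Prop :=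
  exists U : sym_opmonoidal M T, is_cocartesian (EM_sym_monoidal U).

Local Close Scope cat_scope.

Local Open Scope classical_set_scope.
Local Open Scope order_scope.

Section FiniteJoins.
Context {d : Order.disp_t} {B : ctbDistrLatticeType d}.

(* Junk value \bot when F has infinite support; the support is finite in all uses. *)
Definition fjoin (I : Type) (A : set I) (F : I -> B) : B :=
  \big[Order.join / \bot]_(i \in (A : set {classic I})) F i.

Lemma fsjoin_leP (I : choiceType) (A : set I) (F : I -> B) c :
  finite_set [set i | F i != \bot] ->
  (\big[Order.join / \bot]_(i \in A) F i <= c) <-> (forall i, A i -> F i <= c).
Proof.
move=> fF; have fAF : finite_set (setI A (F @^-1` [set~ \bot])).
  by apply: sub_finite_set fF => i [_ /= /eqP].
split.
  move=> le i Ai; have [->//|/eqP Fi] := eqVneq (F i) \bot.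
  have iin : i \in finite_support \bot A F by rewrite in_finite_support// inE.
  exact: le_trans (joins_sup_seq _ iin isT) le.
move=> le; rewrite big_seq; apply/joinsP_seq => i _.
by rewrite in_finite_support// inE => -[Ai _]; exact: le.
Qed.

Lemma fjoin_leP (I : Type) (A : set I) (F : I -> B) c :
  finite_set [set i | F i != \bot] ->
  (fjoin A F <= c) <-> (forall i, A i -> F i <= c).
Proof. exact: (@fsjoin_leP {classic I}). Qed.

Lemma eq_from_ub (a b : B) : (forall c, a <= c <-> b <= c) -> a = b.
Proof. by move=> ab; apply/le_anti/andP; split; apply/ab. Qed.

Lemma leI_compl (a b c : B) : (a `&` b <= c) = (a <= ~` b `|` c).
Proof. by rewrite -[b in LHS]complK -diffE leBLR. Qed.

End FiniteJoins.

Record lset (d : Order.disp_t) (B : ctbDistrLatticeType d) := LSet {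
  lcar :> Type;
  dom : lcar -> B;
  dom_neq0 : forall x, dom x != \bot
}.

Record lmap (d : Order.disp_t) (B : ctbDistrLatticeType d) (X Y : lset B) :=
    LMap {
  lfun :> X -> Y;
  dom_lfun : forall x, dom (lfun x) = dom x
}.

Section LabelledSets.
Context {d : Order.disp_t} {B : ctbDistrLatticeType d}.
Implicit Types X Y Z W : lset B.

Lemma lmap_eq X Y (f g : lmap X Y) : f =1 g -> f = g.
Proof.
case: f g => [f pf] [g pg] /= /funext fg; case: g / fg pg => pg.
by congr LMap; exact: Prop_irrelevance.
Qed.

Definition lmap_id X : lmap X X := @LMap d B X X id (fun=> erefl).

Program Definition lmap_comp X Y Z (g : lmap Y Z) (f : lmap X Y) : lmap X Z :=
  @LMap d B X Z (g \o f) _.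
Next Obligation. by move=> X Y Z g f x /=; rewrite !dom_lfun. Qed.

End LabelledSets.

Program Definition SetB (d : Order.disp_t) (B : ctbDistrLatticeType d) :
    category :=
  @Category (lset B) (@lmap d B) (@lmap_id d B) (@lmap_comp d B) _ _ _.
Next Obligation. by move=> *; exact: lmap_eq. Qed.
Next Obligation. by move=> *; exact: lmap_eq. Qed.
Next Obligation. by move=> *; exact: lmap_eq. Qed.

Record subdist (d : Order.disp_t) (B : ctbDistrLatticeType d) (X : lset B) :=
    Subdist {
  mass :> X -> B;
  mass_fin : finite_set [set x | mass x != \bot];
  mass_ne : exists x, mass x != \bot;
  mass_disj : forall x x', x <> x' -> mass x `&` mass x' = \bot;
  mass_dom : forall x, mass x <= dom x
}.

Section SubdistMonad.
Context {d : Order.disp_t} {B : ctbDistrLatticeType d}.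
Implicit Types X Y Z : lset B.

Lemma subdist_eq X (w v : subdist X) : w =1 v -> w = v.
Proof.
case: w v => [w w1 w2 w3 w4] [v v1 v2 v3 v4] /= /funext wv.
by case: v / wv v1 v2 v3 v4 => *; congr Subdist; exact: Prop_irrelevance.
Qed.

Program Definition sD_obj X : lset B :=
  @LSet d B (subdist X) (fun w => fjoin setT w) _.
Next Obligation.
move=> X w; have [x] := mass_ne w; apply: contra_neq => w0.
apply/eqP; rewrite -lex0; have := lexx (\bot : B).
by rewrite -{1}w0 => /(fjoin_leP _ _ (mass_fin w)); exact.
Qed.

Lemma dom_subdist_leP X (w : sD_obj X) c :
  (dom w <= c) <-> (forall x, (w : subdist X) x <= c).
Proof.
by rewrite (fjoin_leP _ _ (mass_fin w)); split=> h x => [|_]; apply: h.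
Qed.

Definition push_mass X Y (f : lmap X Y) (w : subdist X) (y : Y) : B :=
  fjoin [set x | f x = y] w.

Lemma push_leP X Y (f : lmap X Y) (w : subdist X) y c :
  (push_mass f w y <= c) <-> (forall x, f x = y -> w x <= c).
Proof. exact: (fjoin_leP _ _ (mass_fin w)). Qed.

Lemma le_push X Y (f : lmap X Y) (w : subdist X) x : w x <= push_mass f w (f x).
Proof. by have /push_leP := lexx (push_mass f w (f x)); exact. Qed.

Program Definition push X Y (f : lmap X Y) (w : subdist X) : subdist Y :=
  @Subdist d B Y (push_mass f w) _ _ _ _.
Next Obligation.
move=> X Y f w; apply: sub_finite_set (finite_image f (mass_fin w)) => y /= wy.
apply: contrapT => h; move/negP: wy; apply; rewrite -lex0.
apply/push_leP => x fx; rewrite lex0; apply: contrapT => /negP wx.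
by apply: h; exists x.
Qed.
Next Obligation.
move=> X Y f w; have [x wx] := mass_ne w; exists (f x).
apply: contra_neq wx => h; apply/eqP; rewrite -lex0 -h; exact: le_push.
Qed.
Next Obligation.
move=> X Y f w y y' ny; apply/eqP; rewrite -lex0 leI_compl.
apply/push_leP => x fx; rewrite -leI_compl meetC leI_compl.
apply/push_leP => x' fx'; rewrite -leI_compl mass_disj// => xx'.
by apply: ny; rewrite -fx -fx' xx'.
Qed.
Next Obligation.
move=> X Y f w y; apply/push_leP => x <-; rewrite dom_lfun; exact: mass_dom.
Qed.

Program Definition sD_map X Y (f : lmap X Y) : lmap (sD_obj X) (sD_obj Y) :=
  @LMap d B (sD_obj X) (sD_obj Y) (push f) _.
Next Obligation.
move=> X Y f w; apply: eq_from_ub => c.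
rewrite !dom_subdist_leP; split=> [h x|h y].
  by apply: le_trans (h (f x)); exact: le_push.
by apply/push_leP => x _.
Qed.

Definition unit_mass X (x x' : X) : B := if `[< x' = x >] then dom x else \bot.

Lemma unit_leP X (x x' : X) c : unit_mass x x' <= c <-> (x' = x -> dom x <= c).
Proof.
rewrite /unit_mass; case: asboolP => [e|ne]; last by rewrite le0x.
by split=> // h; exact: h.
Qed.

Program Definition dirac X (x : X) : subdist X :=
  @Subdist d B X (unit_mass x) _ _ _ _.
Next Obligation.
move=> X x; apply: sub_finite_set (finite_set1 x) => x' /=.
by rewrite /unit_mass; case: asboolP => //; rewrite eqxx.
Qed.
Next Obligation.
by move=> X x; exists x; rewrite /unit_mass; case: asboolP => // _; exact: dom_neq0.
Qed.
Next Obligation.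
move=> X x a b ab; rewrite /unit_mass.
case: asboolP => [ax|_]; last by rewrite meet0x.
case: asboolP => [bx|_]; last by rewrite meetx0.
by case: ab; rewrite ax bx.
Qed.
Next Obligation. by move=> X x x'; apply/unit_leP => ->. Qed.

Program Definition sD_eta X : lmap X (sD_obj X) :=
  @LMap d B X (sD_obj X) (@dirac X) _.
Next Obligation.
move=> X x; apply: eq_from_ub => c; rewrite dom_subdist_leP; split=> [h|h x'].
  by move/unit_leP: (h x); exact.
by apply/unit_leP.
Qed.

Definition mu_mass X (W : subdist (sD_obj X)) (x : X) : B :=
  fjoin setT (fun w : subdist X => W w `&` w x).

Lemma mu_leP X (W : subdist (sD_obj X)) x c :
  (mu_mass W x <= c) <-> (forall w : subdist X, W w `&` w x <= c).
Proof.
rewrite fjoin_leP; first by split=> h w => [|_]; apply: h.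
apply: sub_finite_set (mass_fin W) => w /=; apply: contra_neq => ->.
by rewrite meet0x.
Qed.

Lemma le_mu X (W : subdist (sD_obj X)) (w : subdist X) x :
  W w `&` w x <= mu_mass W x.
Proof. by have /mu_leP := lexx (mu_mass W x); exact. Qed.

Lemma mass_sup X (w : subdist X) (a c : B) :
  (forall x, a `&` w x <= c) -> a `&` dom (w : sD_obj X) <= c.
Proof.
move=> h; rewrite meetC leI_compl; apply/dom_subdist_leP => x.
by rewrite -leI_compl meetC.
Qed.

Lemma mu_bound X (W : subdist (sD_obj X)) c :
  (forall x, mu_mass W x <= c) -> forall w, W w <= c.
Proof.
move=> h w; rewrite -(meet_l (mass_dom W w)).
by apply: mass_sup => x; apply: le_trans (h x); exact: le_mu.
Qed.

Program Definition sD_flat X (W : subdist (sD_obj X)) : subdist X :=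
  @Subdist d B X (mu_mass W) _ _ _ _.
Next Obligation.
move=> X W; have := bigcup_finite (mass_fin W) (fun w _ => mass_fin w).
apply: sub_finite_set => x /= mx; apply: contrapT => h.
move/negP: mx; apply; rewrite -lex0; apply/mu_leP => w; rewrite lex0.
have [->|Ww] := eqVneq (W w) \bot; first by rewrite meet0x.
have [->|wx] := eqVneq (w x) \bot; first by rewrite meetx0.
by case: h; exists w.
Qed.
Next Obligation.
move=> X W; apply: contrapT => h; have [w] := mass_ne W.
rewrite -lex0 (mu_bound (W := W))// => x; rewrite lex0.
by apply: contrapT => /negP mx; apply: h; exists x.
Qed.
Next Obligation.
move=> X W x x' xx'; apply/eqP; rewrite -lex0 leI_compl.
apply/mu_leP => w; rewrite -leI_compl meetC leI_compl.
apply/mu_leP => w'; rewrite -leI_compl meetACA.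
have [->|ww'] := pselect (w' = w); last by rewrite (mass_disj W ww') meet0x.
by rewrite [w x' `&` _]meetC (mass_disj w xx') meetx0.
Qed.
Next Obligation.
move=> X W x; apply/mu_leP => w; exact: le_trans (leIr _ _) (mass_dom w x).
Qed.

Program Definition sD_mu X : lmap (sD_obj (sD_obj X)) (sD_obj X) :=
  @LMap d B (sD_obj (sD_obj X)) (sD_obj X) (@sD_flat X) _.
Next Obligation.
move=> X W; apply: eq_from_ub => c; rewrite !dom_subdist_leP; split.
  exact: mu_bound.
by move=> h x; apply/mu_leP => w; apply: le_trans (leIl _ _) (h w).
Qed.

End SubdistMonad.

Program Definition sD (d : Order.disp_t) (B : ctbDistrLatticeType d) :
    monad (SetB B) :=
  @Monad (SetB B) (@sD_obj d B) (@sD_map d B) (@sD_eta d B) (@sD_mu d B)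
    _ _ _ _ _ _ _.
Next Obligation.
move=> d B X; apply: lmap_eq => w; apply: subdist_eq => x; apply: eq_from_ub => c.
by rewrite push_leP; split=> [h|h x' /= ->//]; exact: h.
Qed.
Next Obligation.
move=> d B X Y Z g f; apply: lmap_eq => w; apply: subdist_eq => z.
apply: eq_from_ub => c; rewrite !push_leP; split=> [h y gy|h x gfx].
  by apply/push_leP => x fx; apply: h; rewrite /= fx.
by apply: le_trans (h (f x) gfx); exact: le_push.
Qed.
Next Obligation.
move=> d B X Y f; apply: lmap_eq => x; apply: subdist_eq => y.
apply: eq_from_ub => c; rewrite unit_leP push_leP; split.
  by move=> h x' fx'; apply/unit_leP => e; rewrite -(dom_lfun f x) h// -fx' e.
by move=> h yfx; move/unit_leP: (h x (esym yfx)); rewrite dom_lfun; exact.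
Qed.
Next Obligation.
move=> d B X Y f; apply: lmap_eq => W; apply: subdist_eq => y.
apply: eq_from_ub => c; rewrite mu_leP push_leP; split.
  move=> h x fx; apply/mu_leP => w; apply: le_trans (h (push f w)).
  by rewrite leI2//; [exact: le_push | rewrite -fx; exact: le_push].
move=> h v; rewrite leI_compl; apply/push_leP => w <-.
rewrite -leI_compl meetC leI_compl; apply/push_leP => x fx.
rewrite -leI_compl meetC; apply: le_trans (h x fx); exact: le_mu.
Qed.
Next Obligation.
move=> d B X; apply: lmap_eq => w; apply: subdist_eq => x.
apply: eq_from_ub => c; rewrite mu_leP; split=> [h|h w'].
  rewrite -(meetxx (w x)); apply: le_trans (h w).
  rewrite leI2// /= /unit_mass; case: asboolP => // _.
  by have /dom_subdist_leP := lexx (dom (w : sD_obj X)); exact.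
rewrite leI_compl; apply/unit_leP => ->; apply/dom_subdist_leP => x'.
rewrite -leI_compl.
have [->|xx'] := pselect (x' = x); first exact: le_trans (leIl _ _) h.
by rewrite mass_disj.
Qed.
Next Obligation.
move=> d B X; apply: lmap_eq => w; apply: subdist_eq => x.
apply: eq_from_ub => c; rewrite mu_leP; split=> [h|h v].
  rewrite -[w x](meet_l (mass_dom w x)); apply: le_trans (h (dirac x)).
  rewrite leI2//; first exact: (le_push (sD_eta X)).
  by rewrite /= /unit_mass; case: asboolP.
rewrite leI_compl; apply/push_leP => x' <-; rewrite -leI_compl meetC leI_compl.
by apply/unit_leP => <-; rewrite -leI_compl; exact: le_trans (leIr _ _) h.
Qed.
Next Obligation.
move=> d B X; apply: lmap_eq => WW; apply: subdist_eq => x.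
apply: eq_from_ub => c; rewrite !mu_leP; split=> h.
  move=> w; rewrite leI_compl; apply/push_leP => W <-.
  rewrite -leI_compl meetC leI_compl; apply/mu_leP => v.
  rewrite -leI_compl meetC meetA; apply: le_trans (h v).
  by rewrite leI2//; exact: (le_mu (X := sD_obj X)).
move=> w; rewrite leI_compl; apply/(mu_leP (X := sD_obj X)) => W.
rewrite -leI_compl -meetA; apply: le_trans (h (sD_flat W)).
by rewrite leI2//; [exact: (le_push (sD_mu X)) | exact: le_mu].
Qed.

(* By the convention that X(\bot) is a singleton, an element of [option X] is an
   element of X or the unique element of X(\bot); an element of [star X Y] is a
   pair with disjoint labels whose join differs from \bot, which excludes
   (None, None). *)
Section Star.
Context {d : Order.disp_t} {B : ctbDistrLatticeType d}.
Implicit Types X Y Z W : lset B.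

Definition odom X (ox : option X) : B := oapp (@dom d B X) \bot ox.

Definition star_pred X Y (p : option X * option Y) : bool :=
  (odom p.1 `&` odom p.2 == \bot) && (odom p.1 `|` odom p.2 != \bot).

Program Definition star X Y : lset B :=
  @LSet d B {p : option X * option Y | star_pred p}
    (fun p => odom (val p).1 `|` odom (val p).2) _.
Next Obligation. by move=> X Y [p /= /andP[]]. Qed.

Definition void_lset : lset B :=
  @LSet d B void (fun x => match x with end) (fun x => match x with end).

Lemma odom_omap X Y (f : lmap X Y) ox : odom (omap f ox) = odom ox.
Proof. by case: ox => //= x; rewrite dom_lfun. Qed.

Lemma odom_eq0 X (ox : option X) : odom ox = \bot -> ox = None.
Proof. by case: ox => //= x /eqP; rewrite (negPf (dom_neq0 x)). Qed.

Definition ofst X Y (u : option (star X Y)) : option X :=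
  obind (fun p => (val p).1) u.
Definition osnd X Y (u : option (star X Y)) : option Y :=
  obind (fun p => (val p).2) u.

Definition opair X Y (ox : option X) (oy : option Y) : option (star X Y) :=
  insub (ox, oy).

Lemma opairE X Y (ox : option X) (oy : option Y) :
  odom ox `&` odom oy = \bot ->
  [/\ ofst (opair ox oy) = ox, osnd (opair ox oy) = oy &
      odom (opair ox oy) = odom ox `|` odom oy].
Proof.
move=> dxy; rewrite /opair; case: insubP => [u _ uE|] /=; first by rewrite /odom /= uE.
rewrite /star_pred /= dxy eqxx /= negbK join_eq0 => /andP[/eqP x0 /eqP y0].
by rewrite (odom_eq0 x0) (odom_eq0 y0) joinxx.
Qed.

Lemma odom_star X Y (u : option (star X Y)) :
  odom u = odom (ofst u) `|` odom (osnd u).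
Proof. by case: u => //=; rewrite joinxx. Qed.

Lemma disj_star X Y (u : option (star X Y)) :
  odom (ofst u) `&` odom (osnd u) = \bot.
Proof. by case: u => [[p /= /andP[/eqP]]|] //=; rewrite meetxx. Qed.

Lemma ostar_eq X Y (u v : option (star X Y)) :
  ofst u = ofst v -> osnd u = osnd v -> u = v.
Proof.
move=> e1 e2; have := odom_star u; rewrite e1 e2 -odom_star.
case: u v e1 e2 => [u|] [v|] //=; last first.
- by move=> _ _ /esym/eqP; rewrite (negPf (dom_neq0 v)).
- by move=> _ _ /eqP; rewrite (negPf (dom_neq0 u)).
case: u v => [[a b] u] [[a' b'] v] /= ea eb _; subst a' b'.
by congr Some; exact: val_inj.
Qed.

Lemma lmap_oeq X Y (f g : lmap X Y) :
  (forall ox : option X, omap f ox = omap g ox) -> f = g.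
Proof. by move=> fg; apply: lmap_eq => x; case: (fg (Some x)). Qed.

Program Definition oget X (ox : option X) (ox0 : odom ox != \bot) : X :=
  match ox with Some x => x | None => False_rect _ _ end.
Next Obligation. by move=> X ox ox0 oxN; rewrite -oxN eqxx in ox0. Qed.

Lemma ogetK X (ox : option X) (ox0 : odom ox != \bot) : Some (oget ox0) = ox.
Proof. by case: ox ox0 => //= ox0; exfalso; rewrite eqxx in ox0. Qed.

Program Definition star_mk X Y Z (f : Z -> option X) (g : Z -> option Y)
    (fg0 : forall z, odom (f z) `&` odom (g z) = \bot)
    (fgU : forall z, odom (f z) `|` odom (g z) = dom z) : lmap Z (star X Y) :=
  @LMap d B Z (star X Y) (fun z => exist _ (f z, g z) _) _.
Next Obligation.
by move=> X Y Z f g fg0 fgU z; rewrite /star_pred /= fg0 fgU eqxx dom_neq0.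
Qed.
Next Obligation. by move=> X Y Z f g fg0 fgU z; exact: fgU. Qed.

Lemma omap_star_mk X Y Z (f : Z -> option X) (g : Z -> option Y) fg0 fgU a :
  (ofst (omap (star_mk (f := f) (g := g) fg0 fgU) a) = obind f a) *
  (osnd (omap (star_mk (f := f) (g := g) fg0 fgU) a) = obind g a).
Proof. by case: a. Qed.

Program Definition star_map X X' Y Y' (f : lmap X X') (g : lmap Y Y') :
    lmap (star X Y) (star X' Y') :=
  @star_mk X' Y' (star X Y) (fun u => omap f (val u).1)
    (fun u => omap g (val u).2) _ _.
Next Obligation.
by move=> X X' Y Y' f g u; rewrite !odom_omap; exact: (disj_star (Some u)).
Qed.
Next Obligation. by move=> X X' Y Y' f g u; rewrite !odom_omap. Qed.

Lemma star_mapE X X' Y Y' (f : lmap X X') (g : lmap Y Y') a :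
  (ofst (omap (star_map f g) a) = omap f (ofst a)) *
  (osnd (omap (star_map f g) a) = omap g (osnd a)).
Proof. by case: a. Qed.

Lemma disj3 (r s t : B) : (r `|` s) `&` t = \bot -> r `&` s = \bot ->
  s `&` t = \bot /\ r `&` (s `|` t) = \bot.
Proof.
rewrite meetUl meetUr => /eqP; rewrite join_eq0 => /andP[/eqP rt /eqP st] rs.
by rewrite rs rt joinxx.
Qed.

Lemma disj3' (r s t : B) : r `&` (s `|` t) = \bot -> s `&` t = \bot ->
  r `&` s = \bot /\ (r `|` s) `&` t = \bot.
Proof.
rewrite meetUl meetUr => /eqP; rewrite join_eq0 => /andP[/eqP rs /eqP rt] st.
by rewrite rs rt st joinxx.
Qed.

Lemma star_disjl X Y Z (u : star (star X Y) Z) (a := (val u).1) (b := (val u).2) :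
  odom (osnd a) `&` odom b = \bot /\
  odom (ofst a) `&` (odom (osnd a) `|` odom b) = \bot.
Proof.
apply: disj3 (disj_star a); rewrite -odom_star; exact: (disj_star (Some u)).
Qed.

Lemma star_disjr X Y Z (u : star X (star Y Z)) (a := (val u).1) (b := (val u).2) :
  odom a `&` odom (ofst b) = \bot /\
  (odom a `|` odom (ofst b)) `&` odom (osnd b) = \bot.
Proof.
apply: disj3' (disj_star b); rewrite -odom_star; exact: (disj_star (Some u)).
Qed.

(* ((x, y), z) |-> (x, (y, z)) *)
Program Definition star_assoc X Y Z :
    lmap (star (star X Y) Z) (star X (star Y Z)) :=
  @star_mk X (star Y Z) (star (star X Y) Z) (fun u => ofst (val u).1)
    (fun u => opair (osnd (val u).1) (val u).2) _ _.
Next Obligation.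
move=> X Y Z u; have [yz xyz] := star_disjl u.
by have [_ _ ->] := opairE yz.
Qed.
Next Obligation.
move=> X Y Z u; have [yz xyz] := star_disjl u.
by have [_ _ ->] := opairE yz; rewrite /= [in RHS]odom_star joinA.
Qed.

(* (x, (y, z)) |-> ((x, y), z) *)
Program Definition star_assocV X Y Z :
    lmap (star X (star Y Z)) (star (star X Y) Z) :=
  @star_mk (star X Y) Z (star X (star Y Z))
    (fun u => opair (val u).1 (ofst (val u).2)) (fun u => osnd (val u).2) _ _.
Next Obligation.
move=> X Y Z u; have [xy xyz] := star_disjr u.
by have [_ _ ->] := opairE xy.
Qed.
Next Obligation.
move=> X Y Z u; have [xy xyz] := star_disjr u.
by have [_ _ ->] := opairE xy; rewrite /= [in RHS]odom_star joinA.
Qed.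

Lemma star_assocE X Y Z a :
  (ofst (omap (star_assoc X Y Z) a) = ofst (ofst a)) *
  (ofst (osnd (omap (star_assoc X Y Z) a)) = osnd (ofst a)) *
  (osnd (osnd (omap (star_assoc X Y Z) a)) = osnd a).
Proof.
case: a => //= u; have [yz _] := star_disjl u.
by have [-> -> _] := opairE yz.
Qed.

Lemma star_assocVE X Y Z a :
  (ofst (ofst (omap (star_assocV X Y Z) a)) = ofst a) *
  (osnd (ofst (omap (star_assocV X Y Z) a)) = ofst (osnd a)) *
  (osnd (omap (star_assocV X Y Z) a) = osnd (osnd a)).
Proof.
case: a => //= u; have [xy _] := star_disjr u.
by have [-> -> _] := opairE xy.
Qed.

Lemma ovoid (o : option (void_lset : lset B)) : o = None.
Proof. by case: o => [[]|]. Qed.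

(* (None, x) |-> x *)
Program Definition star_lunit X : lmap (star void_lset X) X :=
  @LMap d B (star void_lset X) X (fun u => @oget X (val u).2 _) _.
Next Obligation.
by move=> X u; have := dom_neq0 u; rewrite /= (ovoid (val u).1) join0x.
Qed.
Next Obligation.
move=> X u; rewrite -[LHS]/(odom (Some _)) ogetK.
by rewrite /= (ovoid (val u).1) join0x.
Qed.

Program Definition star_lunitV X : lmap X (star void_lset X) :=
  @star_mk void_lset X X (fun=> None) Some _ _.
Next Obligation. by move=> X x; exact: meet0x. Qed.
Next Obligation. by move=> X x; exact: join0x. Qed.

(* (x, None) |-> x *)
Program Definition star_runit X : lmap (star X void_lset) X :=
  @LMap d B (star X void_lset) X (fun u => @oget X (val u).1 _) _.
Next Obligation.
by move=> X u; have := dom_neq0 u; rewrite /= (ovoid (val u).2) joinx0.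
Qed.
Next Obligation.
move=> X u; rewrite -[LHS]/(odom (Some _)) ogetK.
by rewrite /= (ovoid (val u).2) joinx0.
Qed.

Program Definition star_runitV X : lmap X (star X void_lset) :=
  @star_mk X void_lset X Some (fun=> None) _ _.
Next Obligation. by move=> X x; exact: meetx0. Qed.
Next Obligation. by move=> X x; exact: joinx0. Qed.

Lemma star_unitE X :
  (forall a, omap (star_lunit X) a = osnd a) *
  (forall a, omap (star_runit X) a = ofst a) *
  (forall a, osnd (omap (star_lunitV X) a) = a) *
  (forall a, ofst (omap (star_runitV X) a) = a).
Proof. by do !split; case=> //= u; exact: ogetK. Qed.

(* (x, y) |-> (y, x) *)
Program Definition star_symm X Y : lmap (star X Y) (star Y X) :=
  @star_mk Y X (star X Y) (fun u => (val u).2) (fun u => (val u).1) _ _.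
Next Obligation. by move=> X Y u; rewrite meetC (disj_star (Some u)). Qed.
Next Obligation. by move=> X Y u; rewrite joinC. Qed.

Lemma star_symmE X Y a :
  (ofst (omap (star_symm X Y) a) = osnd a) *
  (osnd (omap (star_symm X Y) a) = ofst a).
Proof. by case: a. Qed.

Lemma omap_lcomp X Y Z (g : @hom (SetB B) Y Z) (f : @hom (SetB B) X Y)
    (a : option X) :
  omap (@comp (SetB B) X Y Z g f : lmap X Z) a =
  omap (g : lmap Y Z) (omap (f : lmap X Y) a).
Proof. by case: a. Qed.

Lemma omap_lid X (a : option X) : omap (@idm (SetB B) X : lmap X X) a = a.
Proof. by case: a. Qed.

End Star.

Local Ltac star_simp :=
  rewrite ?(omap_lcomp, omap_lid, star_mapE, star_assocE, star_assocVE,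
            star_unitE, star_symmE)//.

Local Ltac star_tac :=
  move=> *; apply: lmap_oeq => ?; star_simp;
  repeat (apply: ostar_eq; star_simp).

Program Definition star_monoidal (d : Order.disp_t) (B : ctbDistrLatticeType d) :
    sym_monoidal (SetB B) :=
  @SymMonoidal (SetB B) (@star d B) (@star_map d B) (@void_lset d B)
    (@star_assoc d B) (@star_assocV d B) (@star_lunit d B) (@star_lunitV d B)
    (@star_runit d B) (@star_runitV d B) (@star_symm d B)
    _ _ _ _ _ _ _ _ _ _ _ _ _ _ _ _.
Next Obligation. star_tac. Qed.
Next Obligation. star_tac. Qed.
Next Obligation. star_tac. Qed.
Next Obligation. star_tac. Qed.
Next Obligation. star_tac. Qed.
Next Obligation. star_tac. Qed.
Next Obligation. star_tac. Qed.
Next Obligation. star_tac. Qed.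
Next Obligation. star_tac. by rewrite [LHS]ovoid [RHS]ovoid. Qed.
Next Obligation. star_tac. Qed.
Next Obligation. star_tac. by rewrite [LHS]ovoid [RHS]ovoid. Qed.
Next Obligation. star_tac. Qed.
Next Obligation. star_tac. Qed.
Next Obligation. star_tac. Qed.
Next Obligation. star_tac. Qed.
Next Obligation. star_tac. Qed.

(* Main.v *)
(** A partial map [p : X -> option Y] that does not increase domains induces a
    pushforward of possibly zero subdistributions, with mass
    [\bigvee_(p x = y) (w x /\ |y|)] at [y], functorially in [p] and compatibly
    with [eta] and [mu].  Pushing [w] on [X * Y] forward along the two partial
    projections splits it into a pair of subdistributions with disjoint domains;
    this is the opmonoidal structure.  Conversely a pair [(x, x')] of elements of
    [X] with disjoint domains yields the subdistribution with mass [|x|] at [x]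
    and [|x'|] at [x'].  Composing this fold [X * X -> sD X] with the structure
    map of an algebra gives a natural codiagonal, and a symmetric monoidal
    category with initial unit and a natural, suitably unital codiagonal is
    cocartesian. *)

Require Import Defs.
From mathcomp Require Import all_boot all_order.
From mathcomp Require Import boolp classical_sets functions cardinality.

Set Implicit Arguments.
Unset Strict Implicit.
Unset Printing Implicit Defensive.

Import Defs Order.Theory.
#[local] Obligation Tactic := idtac.

(** * A codiagonal criterion for cocartesian structure *)

Section Codiagonal.
Local Open Scope cat_scope.
Context (C : category) (M : sym_monoidal C).

Lemma lunitV_nat (X Y : C) (f : hom X Y) :
  lunitV M Y ∘ f = tensm M (idm _) f ∘ lunitV M X.
Proof.
rewrite -[RHS]comp_idl -(lunitK M) -compA (compA (lunit M Y)) lunit_nat.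
by rewrite -(compA f) lunitVK comp_idr.
Qed.

Lemma runitV_nat (X Y : C) (f : hom X Y) :
  runitV M Y ∘ f = tensm M f (idm _) ∘ runitV M X.
Proof.
rewrite -[RHS]comp_idl -(runitK M) -compA (compA (runit M Y)) runit_nat.
by rewrite -(compA f) runitVK comp_idr.
Qed.

(** The copairing of [f] and [g] is [nabla Z ∘ tensm M f g]. The interchange law and naturality of
    [runitV] and [lunitV] reduce its restrictions to the two unit laws of [nabla]. Uniqueness
    follows by sliding [h] through [nabla] and cancelling with the last hypothesis. *)
Lemma is_cocartesian_codiagonal (nabla : forall X : C, hom (tens M X X) X) :
  is_initial (munit M) ->
  (forall (X Y : C) (f : hom X Y), f ∘ nabla X = nabla Y ∘ tensm M f f) ->
  (forall (X : C) (b : hom (munit M) X),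
    nabla X ∘ (tensm M (idm X) b ∘ runitV M X) = idm X) ->
  (forall (X : C) (b : hom (munit M) X),
    nabla X ∘ (tensm M b (idm X) ∘ lunitV M X) = idm X) ->
  (forall (X Y : C) (bX : hom (munit M) X) (bY : hom (munit M) Y),
    nabla (tens M X Y) ∘ tensm M (tensm M (idm X) bY ∘ runitV M X)
      (tensm M bX (idm Y) ∘ lunitV M Y) = idm (tens M X Y)) ->
  is_cocartesian M.
Proof.
move=> init nat nablar nablal nablaij; split=> // X Y bX bY Z f g.
exists (nabla Z ∘ tensm M f g); split; last first.
  move=> h [<- <-]; rewrite tensm_comp compA -nat -compA nablaij.
  exact: comp_idr.
have tensr : tensm M f g ∘ tensm M (idm X) bY =
    tensm M (idm Z) (g ∘ bY) ∘ tensm M f (idm _).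
  by rewrite -!tensm_comp comp_idl !comp_idr.
have tensl : tensm M f g ∘ tensm M bX (idm Y) =
    tensm M (f ∘ bX) (idm Z) ∘ tensm M (idm _) g.
  by rewrite -!tensm_comp comp_idl !comp_idr.
split.
  rewrite -compA (compA (tensm M f g)) tensr -(compA _ _ (runitV M X)).
  by rewrite -runitV_nat (compA _ (runitV M Z)) compA nablar comp_idl.
rewrite -compA (compA (tensm M f g)) tensl -(compA _ _ (lunitV M Y)).
by rewrite -lunitV_nat (compA _ (lunitV M Z)) compA nablal comp_idl.
Qed.

End Codiagonal.

Local Open Scope classical_set_scope.
Local Open Scope order_scope.

(** * Pushforward of possibly zero subdistributions along partial maps *)

Section PartialPushforward.
Context {d : Order.disp_t} {B : ctbDistrLatticeType d}.
Implicit Types X Y Z : lset B.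

(* [None] stands for the zero mass function, which is not a subdistribution. *)
Definition omass X (a : option (sD_obj X)) (x : X) : B :=
  if a is Some w then (w : subdist X) x else \bot.

Lemma omass_dom X (a : option (sD_obj X)) x : omass a x <= dom x.
Proof. by case: a => [w|] /=; [exact: mass_dom | exact: le0x]. Qed.

Lemma omass_disj X (a : option (sD_obj X)) x x' :
  x <> x' -> omass a x `&` omass a x' = \bot.
Proof. by case: a => [w|] /= xx'; [exact: mass_disj | exact: meetxx]. Qed.

Lemma odom_leP X (a : option (sD_obj X)) c :
  odom a <= c <-> (forall x, omass a x <= c).
Proof. by case: a => [w|] /=; [exact: dom_subdist_leP | rewrite le0x]. Qed.

(** Upper bounds determine the masses, and a subdistribution has a non-zero mass somewhere, so it
    cannot agree with [None]. *)
Lemma omass_leP_eq X (a b : option (sD_obj X)) :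
  (forall x c, omass a x <= c <-> omass b x <= c) -> a = b.
Proof.
move=> ab; have {ab} : omass a =1 omass b by move=> x; exact: eq_from_ub.
case: a b => [w|] [v|] //= ab.
- by congr Some; apply: subdist_eq.
- by have [x] := mass_ne w; have /= -> := ab x; rewrite eqxx.
- by have [x] := mass_ne v; have /= <- := ab x; rewrite eqxx.
Qed.

Lemma omass_ex X (m : X -> B) :
  finite_set [set x | m x != \bot] ->
  (forall x x', x <> x' -> m x `&` m x' = \bot) ->
  (forall x, m x <= dom x) ->
  exists a : option (sD_obj X), omass a = m.
Proof.
move=> mfin mdisj mdom.
have [mne|m0] := pselect (exists x, m x != \bot).
  by exists (Some (Subdist mfin mne mdisj mdom)).
exists None; apply/funext => x; apply/esym/eqP.
by apply: contrapT => /negP mx; apply: m0; exists x.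
Qed.

Section Opush.
Context (X Y : lset B) (p : X -> option Y).

(** The meet with [dom y] keeps the mass below the domain of [y] when [p] shrinks domains. *)
Definition opush_mass (w : subdist X) (y : Y) : B :=
  fjoin [set x | p x = Some y] (fun x => w x `&` dom y).

Lemma opush_mass_leP (w : subdist X) y c :
  opush_mass w y <= c <-> (forall x, p x = Some y -> w x `&` dom y <= c).
Proof.
apply: fjoin_leP; apply: sub_finite_set (mass_fin w) => x /=.
by apply: contra_neq => ->; rewrite meet0x.
Qed.

Lemma opush_ex (w : subdist X) :
  exists b : option (sD_obj Y), omass b = opush_mass w.
Proof.
apply: omass_ex => [|y y' yy'|y].
(* The image of the support under [p] lies in [option Y]; its preimage under [Some] bounds the new
   support. *)
- have fin := finite_image p (mass_fin w).
  apply: sub_finite_set (finite_preimage (in2W Some_inj) fin) => y /= my.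
  apply: contrapT => h.
  move/negP: my; apply; rewrite -lex0; apply/opush_mass_leP => x px.
  have [->|wx] := eqVneq (w x) \bot; first by rewrite meet0x.
  by case: h; exists x.
(* Moving a meet across the inequality as a complement lets each join be bounded termwise. Points
   over distinct [y], [y'] are distinct, hence carry disjoint masses. *)
- apply/eqP; rewrite -lex0 leI_compl; apply/opush_mass_leP => x px.
  rewrite -leI_compl meetC leI_compl; apply/opush_mass_leP => x' px'.
  rewrite -leI_compl meetACA (mass_disj w) ?meet0x// => xx'.
  by apply: yy'; apply: Some_inj; rewrite -px -px' xx'.
- by apply/opush_mass_leP => x _; exact: leIr.
Qed.

(** Choice is harmless here, since an element of [option (sD_obj Y)] is determined by its masses. *)
Definition opush (a : option (sD_obj X)) : option (sD_obj Y) :=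
  obind (fun w => projT1 (cid (opush_ex w))) a.

Lemma opush_leP a y c :
  omass (opush a) y <= c <->
  (forall x, p x = Some y -> omass a x `&` dom y <= c).
Proof.
case: a => [w|] /=; last by split=> *; rewrite ?meet0x le0x.
by case: cid => b /= ->; exact: opush_mass_leP.
Qed.

Lemma odom_opush_leP a c :
  odom (opush a) <= c <-> (forall x, omass a x `&` odom (p x) <= c).
Proof.
rewrite odom_leP; split=> h; last by move=> y; apply/opush_leP => x px;
  have := h x; rewrite px.
move=> x; case px: (p x) => [y|] /=; last by rewrite meetx0 le0x.
by have /opush_leP := h y; exact.
Qed.

Lemma le_opush a x y : p x = Some y -> omass a x `&` dom y <= omass (opush a) y.
Proof. by have /opush_leP := lexx (omass (opush a) y); exact. Qed.

End Opush.

(** If [q y = Some z] then [dom z <= dom y], so the intermediate meet with [dom y] is absorbed. *)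
Lemma opush_comp X Y Z (p : X -> option Y) (q : Y -> option Z) a :
  (forall y, odom (q y) <= dom y) ->
  opush q (opush p a) = opush (fun x => obind q (p x)) a.
Proof.
move=> qdom; apply: omass_leP_eq => z c; rewrite !opush_leP; split=> h.
  move=> x; case px: (p x) => [y|] //= qy; apply: le_trans (h y qy).
  have zy : dom z <= dom y by have := qdom y; rewrite qy.
  rewrite lexI leIr andbT; apply: le_trans (le_opush a px).
  by rewrite leI2.
move=> y qy; rewrite leI_compl; apply/opush_leP => x px; rewrite -leI_compl.
apply: le_trans (h x _); last by rewrite px.
by rewrite leI2// leIl.
Qed.

Lemma omass_map_leP X Y (f : lmap X Y) a y c :
  omass (omap (sD_map f) a) y <= c <-> (forall x, f x = y -> omass a x <= c).
Proof.
case: a => [w|] /=; first exact: push_leP.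
by split=> *; exact: le0x.
Qed.

Lemma opush_lmap X Y (f : lmap X Y) a :
  omap (sD_map f) a = opush (fun x => Some (f x)) a.
Proof.
apply: omass_leP_eq => y c; rewrite opush_leP omass_map_leP; split=> h x.
  by case=> fx; apply: le_trans (h x fx); exact: leIl.
move=> fx; apply: le_trans (h x (congr1 Some fx)).
by rewrite lexI lexx -fx dom_lfun omass_dom.
Qed.

Lemma omass_eta_leP X (a : option X) x c :
  omass (omap (sD_eta X) a) x <= c <-> (a = Some x -> dom x <= c).
Proof.
case: a => [x'|] /=; last by rewrite le0x.
rewrite unit_leP; split=> h.
  by case=> e; rewrite -e; apply: h.
by move=> e; rewrite -e; apply: h; rewrite e.
Qed.

Lemma omass_mu_leP X (a : option (sD_obj (sD_obj X))) x c :
  omass (omap (sD_mu X) a) x <= c <->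
  (forall w : sD_obj X, omass a w `&` omass (Some w) x <= c).
Proof.
case: a => [W|] /=; first exact: mu_leP.
by split=> *; rewrite ?meet0x le0x.
Qed.

Lemma opush_eta X Y (p : X -> option Y) (a : option X) :
  (forall x, odom (p x) <= dom x) ->
  opush p (omap (sD_eta X) a) = omap (sD_eta Y) (obind p a).
Proof.
move=> pdom; apply: omass_leP_eq => y c; rewrite opush_leP omass_eta_leP.
split=> h.
  case: a h => //= x h px; apply: le_trans (h x px).
  have := pdom x; rewrite px lexI lexx andbT /= /unit_mass => yx.
  by case: asboolP.
move=> x px; rewrite leI_compl; apply/omass_eta_leP => ax; rewrite -leI_compl.
by apply: le_trans (leIr _ _) (h _); rewrite ax.
Qed.

(** Both masses at [y] are the join of [omass a w], [w x] and [dom y] met together, over all [w] and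
    all [x] with [p x = Some y]; the right-hand side groups the [w] by their pushforward. *)
Lemma opush_mu X Y (p : X -> option Y) (a : option (sD_obj (sD_obj X))) :
  opush p (omap (sD_mu X) a) =
  omap (sD_mu Y) (opush (fun w : sD_obj X => opush p (Some w)) a).
Proof.
apply: omass_leP_eq => y c; rewrite opush_leP omass_mu_leP; split=> h.
  move=> v; rewrite leI_compl; apply/opush_leP => w pw; rewrite -leI_compl.
  rewrite -pw -meetA meetC leI_compl.
  apply: le_trans (leIr _ _) _; apply/opush_leP => x px.
  rewrite -leI_compl meetC meetA; apply: le_trans (h x px).
  rewrite leI2//.
  by have /omass_mu_leP := lexx (omass (omap (sD_mu X) a) x); exact.
move=> x px; rewrite leI_compl; apply/omass_mu_leP => w; rewrite -leI_compl.
rewrite -meetA.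
(* A [w] whose pushforward is zero contributes nothing, because [w x] is then disjoint from
   [dom y]. *)
case pw: (opush p (Some w)) => [v|]; last first.
  by have := le_opush (Some w) px; rewrite pw lex0 => /eqP ->; rewrite meetx0 le0x.
apply: le_trans (h v).
have wv : omass (Some w) x `&` dom y <= omass (Some v) y.
  by rewrite -pw; exact: le_opush.
rewrite lexI; apply/andP; split; last exact: le_trans (leIr _ _) wv.
apply: le_trans (le_opush a pw); rewrite leI2//.
apply: le_trans wv _; exact: (odom_leP (Some v) _).1.
Qed.

End PartialPushforward.

(** * The opmonoidal structure obtained from the partial projections *)

Section Opmonoidal.
Context {d : Order.disp_t} {B : ctbDistrLatticeType d}.
Implicit Types X Y Z : lset B.

Definition sfst X Y (u : star X Y) : option X := (val u).1.
Definition ssnd X Y (u : star X Y) : option Y := (val u).2.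

Lemma sfst_dom X Y (u : star X Y) : odom (sfst u) <= dom u.
Proof. exact: leUl. Qed.

Lemma ssnd_dom X Y (u : star X Y) : odom (ssnd u) <= dom u.
Proof. exact: leUr. Qed.

Lemma opush_sD_map X Y Z (f : lmap X Y) (q : Y -> option Z) a :
  (forall y, odom (q y) <= dom y) ->
  opush q (omap (sD_map f) a) = opush (fun x => q (f x)) a.
Proof. by move=> qdom; rewrite opush_lmap opush_comp. Qed.

Lemma sD_map_opush X Y Z (p : X -> option Y) (f : lmap Y Z) a :
  omap (sD_map f) (opush p a) = opush (fun x => omap f (p x)) a.
Proof. by rewrite opush_lmap opush_comp// => y /=; rewrite dom_lfun. Qed.

Program Definition sD_ups X Y :
    lmap (sD_obj (star X Y)) (star (sD_obj X) (sD_obj Y)) :=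
  @star_mk d B (sD_obj X) (sD_obj Y) (sD_obj (star X Y))
    (fun w => opush (@sfst X Y) (Some w)) (fun w => opush (@ssnd X Y) (Some w))
    _ _.
Next Obligation.
move=> X Y w; apply/eqP; rewrite -lex0 leI_compl; apply/odom_opush_leP => u.
rewrite -leI_compl meetC leI_compl; apply/odom_opush_leP => v.
rewrite -leI_compl.
(* The two components of one point are disjoint by definition of [star]; two different points have
   disjoint masses. *)
have [->|uv] := pselect (u = v).
  by rewrite meetACA [odom _ `&` _]meetC (disj_star (Some v)) meetx0.
by rewrite meetACA (omass_disj (Some w)) ?meet0x// => /esym.
Qed.
Next Obligation.
move=> X Y w; apply: eq_from_ub => c; rewrite leUx dom_subdist_leP; split.
  move=> /andP[/odom_opush_leP h1 /odom_opush_leP h2] u.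
  rewrite -(meet_l (mass_dom w u)) meetUr leUx.
  by apply/andP; split; [exact: h1 | exact: h2].
move=> h; apply/andP; split; apply/odom_opush_leP => u;
  exact: le_trans (leIl _ _) (h u).
Qed.

Lemma sD_upsE X Y a :
  (ofst (omap (sD_ups X Y) a) = opush (@sfst X Y) a) *
  (osnd (omap (sD_ups X Y) a) = opush (@ssnd X Y) a).
Proof. by case: a. Qed.

(** Supports are non-empty, so the monad preserves the empty labelled set; this yields [sD_upsI]. *)
Lemma sD_void (w : sD_obj (void_lset : lset B)) : False.
Proof. by have [[]] := mass_ne w. Qed.

Definition sD_upsI : lmap (sD_obj void_lset) (void_lset : lset B) :=
  @LMap d B (sD_obj void_lset) void_lset
    (fun w => False_rect _ (sD_void w)) (fun w => False_ind _ (sD_void w)).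

End Opmonoidal.

Local Ltac star_simp :=
  rewrite ?(omap_lcomp, omap_lid, star_mapE, star_assocE, star_assocVE,
            star_unitE, star_symmE, sD_upsE)//.

(** Maps into a [star] are compared componentwise, and consecutive pushforwards on either side are
    merged into a single [opush]. *)
Local Ltac star_ext :=
  move=> *; apply: lmap_oeq => ?; star_simp;
  repeat (apply: ostar_eq; star_simp);
  rewrite ?sD_map_opush ?opush_sD_map ?opush_comp//;
  try by [exact: sfst_dom | exact: ssnd_dom].

Program Definition sD_opmonoidal (d : Order.disp_t) (B : ctbDistrLatticeType d) :
    sym_opmonoidal (star_monoidal B) (sD B) :=
  @SymOpmonoidal (SetB B) (star_monoidal B) (sD B) sD_upsI sD_ups
    _ _ _ _ _ _ _ _ _.
Next Obligation. star_ext. Qed.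
Next Obligation.
(* The first component agrees by computation; the other two pass through [opair], which
   [star_assocE] evaluates. *)
star_ext; congr opush; apply/funext => u.
  exact: (esym (star_assocE (Some u)).1.2).
exact: (esym (star_assocE (Some u)).2).
Qed.
Next Obligation.
star_ext; rewrite [RHS]opush_lmap; congr opush; apply/funext => u.
exact: (esym ((star_unitE _).1.1.1 (Some u))).
Qed.
Next Obligation.
star_ext; rewrite [RHS]opush_lmap; congr opush; apply/funext => u.
exact: (esym ((star_unitE _).1.1.2 (Some u))).
Qed.
Next Obligation. star_ext. Qed.
Next Obligation. by star_ext; rewrite [LHS]ovoid [RHS]ovoid. Qed.
Next Obligation.
by star_ext; rewrite [LHS]opush_eta//; [exact: sfst_dom | exact: ssnd_dom].
Qed.
Next Obligation. by star_ext; rewrite [LHS]ovoid [RHS]ovoid. Qed.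
Next Obligation. by star_ext; rewrite [LHS]opush_mu. Qed.

(** * Folding a pair with disjoint domains into a subdistribution *)

Section Fold.
Context {d : Order.disp_t} {B : ctbDistrLatticeType d}.
Implicit Types X Y Z : lset B.

Definition fold_mass X (u : star X X) (x : X) : B :=
  if `[< sfst u = Some x \/ ssnd u = Some x >] then dom x else \bot.

Lemma fold_mass_leP X (u : star X X) x c :
  fold_mass u x <= c <->
  (sfst u = Some x -> dom x <= c) /\ (ssnd u = Some x -> dom x <= c).
Proof.
rewrite /fold_mass; case: asboolP => [ux|nux].
  by split=> [//|[h1 h2]]; case: ux.
by rewrite le0x; split=> // _; split=> e; case: nux; [left | right].
Qed.

Program Definition fold_subdist X (u : star X X) : subdist X :=
  @Subdist d B X (fold_mass u) _ _ _ _.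
Next Obligation.
move=> X u.
have fin : finite_set [set sfst u; ssnd u] by exact: finite_set2.
apply: sub_finite_set (finite_preimage (in2W Some_inj) fin) => x /=.
by rewrite /fold_mass; case: asboolP => [[]->|]; [left | right | rewrite eqxx].
Qed.
Next Obligation.
move=> X u; have := dom_neq0 u; rewrite /= /fold_mass /sfst /ssnd.
case: (val u).1 => [x _|].
  by exists x; case: asboolP => [_|[]]; [exact: dom_neq0 | left].
case: (val u).2 => [x _|]; last by rewrite joinxx eqxx.
by exists x; case: asboolP => [_|[]]; [exact: dom_neq0 | right].
Qed.
Next Obligation.
move=> X u x x' xx'; rewrite /fold_mass.
case: asboolP => [ux|_]; last by rewrite meet0x.
case: asboolP => [ux'|_]; last by rewrite meetx0.
have := disj_star (Some u); rewrite -[ofst _]/(sfst u) -[osnd _]/(ssnd u).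
case: ux ux' => e [] e'.
- by case: xx'; apply: Some_inj; rewrite -e -e'.
- by rewrite e e'.
- by rewrite e e' meetC.
- by case: xx'; apply: Some_inj; rewrite -e -e'.
Qed.
Next Obligation.
by move=> X u x; rewrite /fold_mass; case: ifP => // _; exact: le0x.
Qed.

Program Definition sD_fold X : lmap (star X X) (sD_obj X) :=
  @LMap d B (star X X) (sD_obj X) (@fold_subdist X) _.
Next Obligation.
move=> X u; apply: eq_from_ub => c.
rewrite dom_subdist_leP /= leUx -/(sfst u) -/(ssnd u).
split=> [h|/andP[h1 h2] x].
  have {}h x := (fold_mass_leP u x c).1 (h x).
  case: (sfst u) (ssnd u) h => [x|] [y|] h; rewrite /= ?le0x ?andbT//.
  - by rewrite (h x).1//= (h y).2.
  - exact: (h x).1.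
  - exact: (h y).2.
by apply/fold_mass_leP; split=> e; [move: h1 | move: h2]; rewrite e.
Qed.

Lemma omass_fold_leP X (a : option (star X X)) x c :
  omass (omap (sD_fold X) a) x <= c <->
  (ofst a = Some x -> dom x <= c) /\ (osnd a = Some x -> dom x <= c).
Proof. by case: a => [u|] /=; [exact: fold_mass_leP | rewrite le0x]. Qed.

(** The fold gives each component [w] the coefficient [dom w], which is above [w x]; flattening
    therefore joins the two mass functions. *)
Lemma omass_mu_fold_leP X (a : option (star (sD_obj X) (sD_obj X))) x c :
  omass (omap (sD_mu X) (omap (sD_fold (sD_obj X)) a)) x <= c <->
  omass (ofst a) x <= c /\ omass (osnd a) x <= c.
Proof.
rewrite omass_mu_leP; split=> h.
  have le_c (b : option (sD_obj X)) :
      (forall w, b = Some w -> dom w <= omass (omap (sD_fold (sD_obj X)) a) w) ->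
      omass b x <= c.
    case: b => [w|] hb; last exact: le0x.
    apply: le_trans (h w); rewrite lexI lexx andbT.
    by apply: le_trans (hb w erefl); exact: (dom_subdist_leP w _).1.
  split; apply: le_c => w e.
    by have /omass_fold_leP[] := lexx (omass (omap (sD_fold _) a) w); auto.
  by have /omass_fold_leP[] := lexx (omass (omap (sD_fold _) a) w); auto.
case: h => h1 h2 w; rewrite leI_compl; apply/omass_fold_leP.
by split=> e; rewrite -leI_compl; apply: le_trans (leIr _ _) _; rewrite -e.
Qed.

Lemma sD_fold_nat X Y (f : lmap X Y) a :
  omap (sD_map f) (omap (sD_fold X) a) =
  omap (sD_fold Y) (omap (star_map f f) a).
Proof.
apply: omass_leP_eq => y c; rewrite omass_map_leP omass_fold_leP !star_mapE.
split=> h.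
  split; [case e: (ofst a) => [x|] | case e: (osnd a) => [x|]] => //= -[fx];
    rewrite -fx dom_lfun; have /omass_fold_leP[] := h x fx; auto.
move=> x fx; apply/omass_fold_leP; rewrite -fx !dom_lfun in h *.
by split=> e; [apply: h.1 | apply: h.2]; rewrite e /= fx.
Qed.

(** Both sides have at [x] the join of [omass a u] met with [dom x], over all [u] having [x] as a
    component. This is the identity that makes the codiagonal an algebra map. *)
Lemma mu_fold_ups X a :
  omap (sD_mu X) (omap (sD_fold (sD_obj X)) (omap (sD_ups X X) a)) =
  omap (sD_mu X) (omap (sD_map (sD_fold X)) a).
Proof.
apply: omass_leP_eq => x c; rewrite omass_mu_fold_leP omass_mu_leP !sD_upsE.
rewrite !opush_leP; split=> [[h1 h2] w|h].
  rewrite leI_compl; apply/omass_map_leP => u <-; rewrite -leI_compl meetC.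
  rewrite leI_compl; apply/fold_mass_leP.
  by split=> e; rewrite -leI_compl meetC; [exact: h1 | exact: h2].
have {}h u : omass a u `&` fold_mass u x <= c.
  apply: le_trans (h (sD_fold X u)); rewrite leI2//.
  have := lexx (omass (omap (sD_map (sD_fold X)) a) (sD_fold X u)).
  by move/omass_map_leP; exact.
by split=> u e; apply: le_trans (h u); rewrite leI2// /fold_mass;
  case: asboolP => // -[]; [left | right].
Qed.

(** A component [x] carries mass [dom x], whose meet with [dom y] is [dom y] whenever
    [p x = Some y]. *)
Lemma opush_fold_leP X Y (p : X -> option Y) a y c :
  (forall x, odom (p x) <= dom x) ->
  omass (opush p (omap (sD_fold X) a)) y <= c <->
  (obind p (ofst a) = Some y -> dom y <= c) /\
  (obind p (osnd a) = Some y -> dom y <= c).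
Proof.
move=> pdom; rewrite opush_leP; split=> [h|[h1 h2] x px].
  have {}h x : p x = Some y -> dom x <= omass (omap (sD_fold X) a) x ->
      dom y <= c.
    move=> px xa; apply: le_trans (h x px); rewrite lexI lexx andbT.
    by apply: le_trans xa; have := pdom x; rewrite px.
  split.
    case e: (ofst a) => [x|] //= px; apply: (h x px).
    by have /omass_fold_leP[] := lexx (omass (omap (sD_fold X) a) x); auto.
  case e: (osnd a) => [x|] //= px; apply: (h x px).
  by have /omass_fold_leP[] := lexx (omass (omap (sD_fold X) a) x); auto.
rewrite leI_compl; apply/omass_fold_leP; split=> e; rewrite -leI_compl;
  apply: le_trans (leIr _ _) _; [apply: h1 | apply: h2]; by rewrite e.
Qed.

(** The hypotheses say that [i] and [j] act as injections, so each projection of the fold sees only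
    its own component and returns a Dirac subdistribution, or zero if that component is absent. *)
Lemma ups_fold X Y (i : lmap X (star X Y)) (j : lmap Y (star X Y)) a :
  (forall ox, ofst (omap i ox) = ox) -> (forall ox, osnd (omap i ox) = None) ->
  (forall oy, ofst (omap j oy) = None) -> (forall oy, osnd (omap j oy) = oy) ->
  omap (sD_ups X Y) (omap (sD_fold (star X Y)) (omap (star_map i j) a)) =
  omap (star_map (sD_eta X) (sD_eta Y)) a.
Proof.
move=> i1 i2 j1 j2; apply: ostar_eq; rewrite sD_upsE star_mapE;
  apply: omass_leP_eq => z c; rewrite omass_eta_leP opush_fold_leP;
  [| exact: sfst_dom | | exact: ssnd_dom]; rewrite !star_mapE.
  rewrite -[obind _ (omap i _)]/(ofst _) -[obind _ (omap j _)]/(ofst _) i1 j1.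
  by split=> [[]|].
rewrite -[obind _ (omap i _)]/(osnd _) -[obind _ (omap j _)]/(osnd _) i2 j2.
by split=> [[]|].
Qed.

End Fold.

(** * Codiagonals and coproducts of algebras *)

Section EilenbergMooreCoproducts.
Local Open Scope cat_scope.
Context {d : Order.disp_t} {B : ctbDistrLatticeType d}.
Local Notation EM_star := (EM_sym_monoidal (sD_opmonoidal B)).
Implicit Types A D : algebra (sD B).

(** The structure map retyped as an [lmap], so that [omap] applies to it. *)
Definition lact A : lmap (sD_obj (acar A)) (acar A) := act A.

Lemma act_etaE A a : omap (lact A) (omap (sD_eta (acar A)) a) = a.
Proof. by rewrite -(omap_lcomp (act A)) [_ ∘ _]act_eta omap_lid. Qed.

Lemma act_muE A a :
  omap (lact A) (omap (sD_mu (acar A)) a) =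
  omap (lact A) (omap (sD_map (lact A)) a).
Proof.
rewrite -!(omap_lcomp (act A)).
exact: (congr1 (fun g : lmap _ _ => omap g a) (act_mu A)).
Qed.

Lemma ahom_actE A D (f : algebra_hom A D) a :
  omap (ahom f : lmap (acar A) (acar D)) (omap (lact A) a) =
  omap (lact D) (omap (sD_map (ahom f)) a).
Proof.
rewrite -(omap_lcomp (ahom f)) -(omap_lcomp (act D)).
exact: (congr1 (fun g : lmap _ _ => omap g a) (ahom_act f)).
Qed.

(** The algebra map law combines naturality of the fold, associativity of the action and
    [mu_fold_ups]. *)
Program Definition codiag A :
    @hom (EM (sD B)) (tens EM_star A A) A :=
  @AlgebraHom _ (sD B) (tens EM_star A A) A (act A ∘ sD_fold (acar A)) _.
Next Obligation.
move=> A; apply: lmap_oeq => a; rewrite mmap_comp !omap_lcomp.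
transitivity (omap (lact A) (omap (sD_mu (acar A))
    (omap (sD_map (sD_fold (acar A))) a))); last exact: act_muE.
by rewrite -mu_fold_ups act_muE sD_fold_nat.
Qed.

Lemma codiag_nat A D (f : @hom (EM (sD B)) A D) :
  f ∘ codiag A = codiag D ∘ tensm EM_star f f.
Proof.
apply: algebra_hom_eq; apply: lmap_oeq => a; rewrite !omap_lcomp.
by rewrite [LHS]ahom_actE (sD_fold_nat (ahom f)).
Qed.

(** Without a second component the fold is a Dirac subdistribution, which the action undoes. *)
Lemma act_fold_l A (a : option (star (acar A) (acar A))) :
  osnd a = None -> omap (lact A) (omap (sD_fold (acar A)) a) = ofst a.
Proof.
move=> a2; rewrite -[RHS]act_etaE; congr omap; apply: omass_leP_eq => x c.
by rewrite omass_fold_leP omass_eta_leP a2; split=> [[]|].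
Qed.

Lemma act_fold_r A (a : option (star (acar A) (acar A))) :
  ofst a = None -> omap (lact A) (omap (sD_fold (acar A)) a) = osnd a.
Proof.
move=> a1; rewrite -[RHS]act_etaE; congr omap; apply: omass_leP_eq => x c.
by rewrite omass_fold_leP omass_eta_leP a1; split=> [[]|].
Qed.

(** The algebra law is vacuous, as [sD_obj void_lset] has no elements. *)
Lemma munit_initial : is_initial (munit EM_star).
Proof.
move=> A; pose f : @hom (SetB B) (@void_lset d B) (acar A) :=
  @LMap d B void_lset (acar A) (fun x : void => match x with end)
    (fun x : void => match x with end).
have f_act : f ∘ act (munit EM_star) = act A ∘ mmap (sD B) f.
  by apply: lmap_eq => w; case: (sD_void w).
exists (@AlgebraHom _ _ (munit EM_star) A f f_act); split=> // g _.
by apply: algebra_hom_eq; apply: lmap_eq => -[].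
Qed.

Lemma inl_starE (A D : EM (sD B)) (b : @hom (EM (sD B)) (munit EM_star) D) a :
  let i := tensm EM_star (idm A) b ∘ runitV EM_star A in
  (ofst (omap (ahom i : lmap (acar A) (star (acar A) (acar D))) a) = a) *
  (osnd (omap (ahom i : lmap (acar A) (star (acar A) (acar D))) a) = None).
Proof. by case: a. Qed.

Lemma inr_starE (A D : EM (sD B)) (b : @hom (EM (sD B)) (munit EM_star) A) a :
  let j := tensm EM_star b (idm D) ∘ lunitV EM_star D in
  (ofst (omap (ahom j : lmap (acar D) (star (acar A) (acar D))) a) = None) *
  (osnd (omap (ahom j : lmap (acar D) (star (acar A) (acar D))) a) = a).
Proof. by case: a. Qed.

Lemma EM_star_cocartesian : is_cocartesian EM_star.
Proof.
apply (@is_cocartesian_codiagonal _ EM_star codiag).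
- exact: munit_initial.
- exact: codiag_nat.
- move=> A b; apply: algebra_hom_eq; apply: lmap_oeq => a.
  rewrite (omap_lcomp (act A ∘ _)) omap_lcomp omap_lid.
  by rewrite [LHS]act_fold_l inl_starE.
- move=> A b; apply: algebra_hom_eq; apply: lmap_oeq => a.
  rewrite (omap_lcomp (act A ∘ _)) omap_lcomp omap_lid.
  by rewrite [LHS]act_fold_r inr_starE.
move=> A D bA bD; apply: algebra_hom_eq; apply: lmap_oeq => a.
rewrite !omap_lcomp omap_lid.
(* The action on the tensor algebra starts with [sD_ups], which turns the fold of the injections
   into a pair of units; the two actions then cancel them. *)
transitivity (omap (star_map (lact A) (lact D))
    (omap (star_map (sD_eta (acar A)) (sD_eta (acar D))) a)).
  congr omap; apply: ups_fold => o;
    by [exact: (inl_starE bD o).1 | exact: (inl_starE bD o).2 |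
        exact: (inr_starE bA o).1 | exact: (inr_starE bA o).2].
by apply: ostar_eq; rewrite !star_mapE act_etaE.
Qed.

End EilenbergMooreCoproducts.

Theorem proposition58 (d : Order.disp_t) (B : ctbDistrLatticeType d)
    (B_nontrivial : (\bot != \top :> B)%O) :
  linear_exponential (star_monoidal B) (sD B).
Proof. by exists (sD_opmonoidal B); exact: EM_star_cocartesian. Qed.
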